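(* If $H$ is a $3$-graph with maximum degree at most $\Delta$, then $$\mathrm{ex}(H,\mathbf{F})\ge \Delta^{-3/5-o(1)}\cdot e(H).$$
   Context: A $3$-graph is a $3$-uniform hypergraph; $e(H)$ is its number of edges; the maximum degree is the maximum number of edges containing a given vertex. $\mathrm{ex}(H,F)$ is the maximum number of edges in a subgraph of $H$ containing no subgraph isomorphic to $F$. $\mathbf{F}$ is the $3$-graph on six distinct vertices $u_1,u_2,u_3,v_1,v_2,v_3$ with the four edges $\{u_1,u_2,u_3\},\{u_1,u_2,v_1\},\{u_3,v_2,v_3\},\{v_1,v_2,v_3\}$ (a $3$-uniform Berge $4$-cycle). Asymptotics are as $\Delta\to\infty$: for every $\varepsilon>0$ there is $\Delta_0$ such that for all $\Delta\ge\Delta_0$ and all $3$-graphs $H$ with maximum degree at most $\Delta$ the inequality holds with $o(1)$ replaced by $\varepsilon$. *)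

(* Defs.v *)
From mathcomp Require Import all_boot.

Set Implicit Arguments.
Unset Strict Implicit.
Unset Printing Implicit Defensive.

(* A hypergraph on the finite vertex type T is identified with its edge set,
   so e(H) is #|H| and a subgraph is, up to isolated vertices, a subset. *)

Definition three_graph (T : finType) (H : {set {set T}}) : bool :=
  [forall e in H, #|e| == 3].

Definition degree (T : finType) (H : {set {set T}}) (x : T) : nat :=
  #|[set e in H | x \in e]|.

Definition max_degree (T : finType) (H : {set {set T}}) : nat :=
  \max_(x : T) degree H x.

(* G has a (not necessarily induced) subgraph isomorphic to K. *)
Definition contains_copy (U T : finType) (K : {set {set U}})
    (G : {set {set T}}) : bool :=
  [exists f : {ffun U -> T}, injectiveb f && [forall e in K, f @: e \in G]].

Definition ex_number (U T : finType) (H : {set {set T}}) (K : {set {set U}}) : nat :=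
  \max_(G : {set {set T}} | (G \subset H) && ~~ contains_copy K G) #|G|.

Definition berge_C4 : {set {set 'I_6}} :=
  let u1 := @Ordinal 6 0 isT in
  let u2 := @Ordinal 6 1 isT in
  let u3 := @Ordinal 6 2 isT in
  let v1 := @Ordinal 6 3 isT in
  let v2 := @Ordinal 6 4 isT in
  let v3 := @Ordinal 6 5 isT in
  [set [set u1; u2; u3]; [set u1; u2; v1]; [set u3; v2; v3]; [set v1; v2; v3]].

(* Main.v *)
(* The lower bound obtained is of order [Delta^(-1/2) e(H)], which is stronger than needed.
   Let [s] be about [sqrt Delta]. If most edges contain only pairs of codegree
   below [s], a maximal linear subgraph has at least [e(H) / O(s)] edges, and
   it contains no copy of F because two edges of F share two vertices.
   Otherwise consider the triples [(x, y, z)] which are edges whose pair [xy]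
   has codegree at least [s]. Then [x] lies in at most [O(Delta / s) = O(s)]
   such pairs, hence for given [x, z] only [O(s)] such triples exist, and
   likewise for given [y, z]. Take a finite field of order [q = O(s)], map [x]
   and [y] to random field elements and [z] to a random non-vertical,
   non-horizontal line, and keep the triples for which the line of [z] passes
   through the point given by [(x, y)]; this happens with probability about
   [1 / q]. Given that, with probability at least 1/2 no other triple collides with it.
   In the resulting subgraph each pair [xz] or [yz] is in at most one triple,
   so that a copy of F would yield two lines with two points in common. *)
Require Import Defs.
From HB Require Import structures.
From mathcomp Require Import all_boot all_order all_algebra finfield.
From mathcomp Require Import all_classical all_reals all_analysis.
From mathcomp Require Import zify lra fintype finset.
Import Order.TTheory GRing.Theory Num.Theory.

Set Implicit Arguments.
Unset Strict Implicit.

Local Open Scope nat_scope.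

(** * Counting colourings by changing one colour *)

Definition recolor (T : finType) (C : Type) (f : {ffun T -> C}) (v : T) (c : C) :
  {ffun T -> C} := [ffun w => if w == v then c else f w].

Lemma recolor_same (T : finType) (C : Type) (f : {ffun T -> C}) v c :
  recolor f v c v = c.
Proof. by rewrite ffunE eqxx. Qed.

Lemma recolor_other (T : finType) (C : Type) (f : {ffun T -> C}) v c w :
  w != v -> recolor f v c w = f w.
Proof. by rewrite ffunE => /negbTE ->. Qed.

(* Exchanging [c] with the colour of [v] is an involution on the pairs [(f, c)]
   which turns the condition on [f v] into the same condition on [c]. *)
Lemma card_recolor (T C : finType) (E : pred {ffun T -> C})
    (S : {ffun T -> C} -> pred C) (v : T) (m : nat) :
  (forall f c, E (recolor f v c) = E f) ->
  (forall f c c', S (recolor f v c) c' = S f c') ->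
  (forall f, E f -> #|S f| = m) ->
  #|[set f | E f && S f (f v)]| * #|C| = m * #|[set f | E f]|.
Proof.
move=> HE HS Hm.
pose phi (p : {ffun T -> C} * C) := (recolor p.1 v p.2, p.1 v).
have phiK : involutive phi.
  case=> f c; rewrite /phi /= recolor_same; congr pair.
  by apply/ffunP => w; rewrite !ffunE; case: eqP => // ->.
transitivity (\sum_(f | E f) \sum_(c | S f c) 1); last first.
  rewrite -sum1dep_card big_distrr /=.
  by apply: eq_bigr => f Ef; rewrite sum1_card Hm // muln1.
rewrite pair_big_dep /= (reindex_inj (inv_inj phiK)) /=.
under eq_bigl => p do rewrite HE HS -[_ && _]andbT.
rewrite -(pair_big_dep (fun f => E f && S f (f v)) (fun _ _ => true) (fun _ _ => 1)) /=.
rewrite -sum1dep_card big_distrl /=.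
by apply: eq_bigr => f _; rewrite sum1_card mul1n.
Qed.

(** * Triples, copies of F, and a union bound *)

Lemma eq_set3 (T : finType) (a b c x y z : T) :
  uniq [:: x; y; z] -> [set a; b; c] = [set x; y; z] ->
  [\/ (x, y, z) = (a, b, c), (x, y, z) = (a, c, b), (x, y, z) = (b, a, c) |
   [\/ (x, y, z) = (b, c, a), (x, y, z) = (c, a, b) | (x, y, z) = (c, b, a)]].
Proof.
move=> + E.
have : [/\ x \in [set a; b; c], y \in [set a; b; c] & z \in [set a; b; c]].
  by rewrite E !inE !eqxx ?orbT.
case; rewrite !inE -!orbA => /or3P[] /eqP-> /or3P[] /eqP-> /or3P[] /eqP->;
  rewrite /= !inE ?eqxx ?orbT ?andbF //= => _;
  by [constructor 1 | constructor 2 | constructor 3 |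
     constructor 4; constructor 1 | constructor 4; constructor 2
     | constructor 4; constructor 3].
Qed.

Lemma contains_berge_C4P (T : finType) (G : {set {set T}}) :
  contains_copy berge_C4 G ->
  exists u1 u2 u3 v1 v2 v3 : T,
    [/\ uniq [:: u1; u2; u3; v1; v2; v3],
        [set u1; u2; u3] \in G, [set u1; u2; v1] \in G,
        [set u3; v2; v3] \in G & [set v1; v2; v3] \in G].
Proof.
case/existsP => f /andP[/injectiveP f_inj /forallP fG].
have fG' e : e \in berge_C4 -> f @: e \in G by apply/implyP.
pose o i (Hi : i < 6) := Ordinal Hi.
exists (f (o 0 isT)), (f (o 1 isT)), (f (o 2 isT)), (f (o 3 isT)),
  (f (o 4 isT)), (f (o 5 isT)).
have img i j k : f @: [set i; j; k] = [set f i; f j; f k].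
  by rewrite !imsetU !imset_set1.
split; rewrite -?img; try by apply: fG'; rewrite !inE eqxx ?orbT.
rewrite -[X in uniq X]/(map f [:: o 0 isT; o 1 isT; o 2 isT; o 3 isT; o 4 isT; o 5 isT]).
by rewrite map_inj_uniq.
Qed.

Lemma leq_card_bigcup (I T : finType) (P : pred I) (A : I -> {set T}) :
  #|\bigcup_(i | P i) A i| <= \sum_(i | P i) #|A i|.
Proof.
elim/big_ind2: _ => [|m B n C Bm Cn|//]; first by rewrite cards0.
by apply: leq_trans (leq_card_setU B C).1 _; exact: leq_add.
Qed.

Lemma leq_ex_number (U T : finType) (H G : {set {set T}}) (K : {set {set U}}) :
  G \subset H -> ~ contains_copy K G -> #|G| <= ex_number H K.
Proof.
by move=> GH /negP nK; apply: (leq_bigmax_cond (F := fun G => #|pred_of_set G|)); rewrite GH.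
Qed.

(** * Edges all of whose pairs have low codegree *)

Definition codegree (T : finType) (H : {set {set T}}) (x y : T) : nat :=
  #|[set e in H | (x \in e) && (y \in e)]|.

Definition linear (T : finType) (G : {set {set T}}) : bool :=
  [forall e in G, forall g in G, (1 < #|e :&: g|) ==> (e == g)].

Lemma linearP (T : finType) (G : {set {set T}}) :
  reflect (forall e g, e \in G -> g \in G -> 1 < #|e :&: g| -> e = g) (linear G).
Proof.
apply: (iffP forall_inP) => [lin e g eG gG eg | lin e eG].
  by move/forall_inP: (lin e eG) => /(_ g gG) /implyP /(_ eg) /eqP.
by apply/forall_inP => g gG; apply/implyP => eg; apply/eqP/lin.
Qed.

(** The first two edges of F share [u1] and [u2], so linearity would make them equal, although [u3]
    is not in the second. *)
Lemma linear_berge_C4_free (T : finType) (G : {set {set T}}) :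
  linear G -> ~ contains_copy berge_C4 G.
Proof.
move=> /linearP lin /contains_berge_C4P [u1 [u2 [u3 [v1 [v2 [v3]]]]]].
rewrite /= !inE !negb_or -!andbA => -[/and5P[u12 u13 _ _ /andP[_ /and5P[u23 _ _ _ /and4P[u3v1 _ _ _]]]]].
move=> E1 E2 _ _.
have E : [set u1; u2; u3] = [set u1; u2; v1].
  by apply: lin => //; apply/card_gt1P; exists u1, u2; rewrite !inE !eqxx !orbT.
move/setP/(_ u3): E; rewrite !inE eqxx !orbT.
by rewrite (negbTE u3v1) ![u3 == _]eq_sym (negbTE u13) (negbTE u23).
Qed.

(** By maximality, every edge of [L] shares two vertices with some edge of a maximal linear [G]
    inside [L]. An edge of [G] has 9 ordered pairs of vertices, and each pair of distinct ones lies
    in fewer than [s] edges of [H]. *)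
Lemma card_low_codegree (T : finType) (H : {set {set T}}) (s : nat) :
  three_graph H ->
  #|[set e in H | [forall x in e, forall y in e, (x != y) ==> (codegree H x y < s)]]|
    <= 9 * s * ex_number H berge_C4.
Proof.
move=> /forall_inP H3; set L := [set e in H | _].
have [G /maxsetP[/andP[GL linG] maxG]] :
    {G | maxset (fun G : {set {set T}} => (G \subset L) && linear G) G}.
  by apply: ex_maxset; exists set0; rewrite sub0set; apply/linearP => e g; rewrite inE.
have LH : L \subset H by apply/subsetP => e; rewrite inE => /andP[].
have exG : #|G| <= ex_number H berge_C4.
  apply: leq_ex_number; first exact: subset_trans LH.
  exact: linear_berge_C4_free.
pose near (g : {set T}) := [set e in H | 1 < #|e :&: g|].
have L_near : L \subset \bigcup_(g in G) near g.
  apply/subsetP => e eL; apply/bigcupP.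
  have eH : e \in H by move/subsetP: LH; apply.
  case: (boolP [exists g in G, 1 < #|e :&: g|]) => [/exists_inP[g gG eg] | far].
    by exists g => //; rewrite inE eH.
  have farP g : g \in G -> 1 < #|e :&: g| -> False.
    by move=> gG eg; case/negP: far; apply/exists_inP; exists g.
  (* An edge sharing at most one vertex with each edge of [G] can be added to [G] without losing
     linearity. *)
  have eG : e \in G.
    rewrite -(maxG (e |: G)); first by rewrite !inE eqxx.
      rewrite subUset sub1set eL GL; apply/linearP => f g.
      rewrite !inE => /predU1P[-> | fG] /predU1P[-> | gG] //.
      - by move/(farP g gG).
      - by rewrite setIC => /(farP f fG).
      - by move/linearP: linG; apply.
    exact: subsetUr.
  by exists e => //; rewrite inE eH setIid (eqP (H3 e eH)).
have card_near g : g \in G -> #|near g| <= 9 * s.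
  move=> gG; have gL : g \in L by move/subsetP: GL; apply.
  move: (gL); rewrite inE => /andP[gH /forall_inP low].
  have cover : near g \subset \bigcup_(p in setX g g | p.1 != p.2)
      [set e in H | (p.1 \in e) && (p.2 \in e)].
    apply/subsetP => e; rewrite inE => /andP[eH /card_gt1P[x [y []]]].
    rewrite !inE => /andP[xe xg] /andP[ye yg] xy; apply/bigcupP.
    by exists (x, y); rewrite /= !inE ?xg ?yg ?xe ?ye ?eH.
  apply: leq_trans (subset_leq_card cover) _.
  apply: leq_trans (leq_card_bigcup _ _) _.
  apply: (@leq_trans (\sum_(p in setX g g) s)); last first.
    by rewrite sum_nat_const cardsX (eqP (H3 g gH)).
  rewrite [X in _ <= X](bigID (fun p => p.1 != p.2)) /=.
  apply: leq_trans (leq_addr _ _); apply: leq_sum => -[x y] /=.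
  rewrite !inE /= => /andP[/andP[xg yg] xy].
  by move/forall_inP: (low x xg) => /(_ y yg) /implyP /(_ xy) /ltnW.
apply: leq_trans (subset_leq_card L_near) _.
apply: leq_trans (leq_card_bigcup _ _) _.
apply: (@leq_trans (\sum_(g in G) 9 * s)); first exact: leq_sum.
by rewrite sum_nat_const mulnC leq_mul.
Qed.

(** Union bound free of division: each event has probability [1 / k] in a space of size [m]. *)
Lemma leq_card_bigcup_mul (I T : finType) (D : {set I}) (A : I -> {set T}) (k m : nat) :
  (forall i, i \in D -> #|A i| * k = m) -> #|\bigcup_(i in D) A i| * k <= #|D| * m.
Proof.
move=> Ak; have -> : #|D| * m = (\sum_(i in D) #|A i|) * k.
  by rewrite big_distrl (eq_bigr (fun=> m) Ak) sum_nat_const.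
by rewrite leq_mul2r leq_card_bigcup orbT.
Qed.

(** * Pairs of high codegree *)

Lemma codegreeC (T : finType) (H : {set {set T}}) (x y : T) :
  codegree H x y = codegree H y x.
Proof. by apply: eq_card => e; rewrite !inE; congr andb; rewrite andbC. Qed.

(** An edge through [x] is counted once for each of its three vertices, [x] included:
    [codegree H x x] is the degree of [x]. *)
Lemma sum_codegree (T : finType) (H : {set {set T}}) (x : T) :
  three_graph H -> \sum_y codegree H x y = 3 * degree H x.
Proof.
move=> /forall_inP H3; rewrite mulnC -sum_nat_const.
under eq_bigr => y _ do rewrite /codegree -sum1dep_card.
rewrite (exchange_big_dep (mem [set e in H | x \in e])) /=; last first.
  by move=> y e _; rewrite !inE => /and3P[-> ->].
apply: eq_bigr => e; rewrite inE => /andP[eH xe].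
by rewrite eH xe /= sum1_card (eqP (H3 e eH)).
Qed.

Lemma degree_le (T : finType) (H : {set {set T}}) (x : T) : degree H x <= max_degree H.
Proof. exact: (leq_bigmax x). Qed.

(** The codegrees at [x] sum to at most [3 * s ^ 2], and each counted [y] contributes at least
    [s]. *)
Lemma card_high_codegree (T : finType) (H : {set {set T}}) (s : nat) (x : T) :
  three_graph H -> max_degree H <= s ^ 2 -> 0 < s ->
  #|[set y | s <= codegree H x y]| <= 3 * s.
Proof.
move=> H3 dH s_gt0; rewrite -(leq_pmul2r s_gt0) -mulnA mulnn.
rewrite -sum_nat_const; apply: (@leq_trans (\sum_y codegree H x y)).
  rewrite [X in _ <= X](bigID (mem [set y | s <= codegree H x y])) /=.
  by apply: leq_trans (leq_addr _ _); apply: leq_sum => y; rewrite inE.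
by rewrite sum_codegree // leq_mul2l (leq_trans (degree_le _ _)).
Qed.

(** * Heavy triples, their replacements, and the incidence condition *)

Definition heavy (T : finType) (H : {set {set T}}) (s : nat) : {set T * T * T} :=
  [set t | [&& uniq [:: t.1.1; t.1.2; t.2], [set t.1.1; t.1.2; t.2] \in H &
               s <= codegree H t.1.1 t.1.2]].

(* The replacements of one or two vertices of [t] which give another triple of
   [W]; [t] is discarded if one of them has the colour of what it replaces. *)
Definition swap1 (T : finType) (W : {set T * T * T}) (t : T * T * T) : {set T} :=
  [set x | (x != t.1.1) && ((x, t.1.2, t.2) \in W)].
Definition swap2 (T : finType) (W : {set T * T * T}) (t : T * T * T) : {set T} :=
  [set y | (y != t.1.2) && ((t.1.1, y, t.2) \in W)].
Definition swap3 (T : finType) (W : {set T * T * T}) (t : T * T * T) : {set T} :=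
  [set z | (z != t.2) && ((t.1.1, t.1.2, z) \in W)].
Definition swap12 (T : finType) (W : {set T * T * T}) (t : T * T * T) : {set T * T} :=
  [set p | [&& p.1 \notin [:: t.1.1; t.1.2], p.2 \notin [:: t.1.1; t.1.2] &
               (p, t.2) \in W]].

(** A replacement of the first vertex again has codegree at least [s] with the second, which leaves
    [O(s)] candidates instead of [O(s ^ 2)]. *)
Lemma card_swap1 (T : finType) (H : {set {set T}}) (s : nat) t :
  three_graph H -> max_degree H <= s ^ 2 -> 0 < s ->
  #|swap1 (heavy H s) t| <= 3 * s.
Proof.
move=> H3 dH s_gt0; apply: leq_trans (card_high_codegree t.1.2 H3 dH s_gt0).
apply/subset_leq_card/subsetP => x; rewrite !inE codegreeC.
by case/and4P.
Qed.

Lemma card_swap2 (T : finType) (H : {set {set T}}) (s : nat) t :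
  three_graph H -> max_degree H <= s ^ 2 -> 0 < s ->
  #|swap2 (heavy H s) t| <= 3 * s.
Proof.
move=> H3 dH s_gt0; apply: leq_trans (card_high_codegree t.1.1 H3 dH s_gt0).
by apply/subset_leq_card/subsetP => x; rewrite !inE; case/and4P.
Qed.

(** Different [z] give different edges through the first vertex. This weaker bound of order [s ^ 2],
    as for [swap12], suffices because these collisions require two equal field elements. *)
Lemma card_swap3 (T : finType) (H : {set {set T}}) (s : nat) t :
  #|swap3 (heavy H s) t| <= max_degree H.
Proof.
apply: leq_trans (degree_le H t.1.1).
rewrite -(card_in_imset (f := fun z => [set t.1.1; t.1.2; z])).
  apply/subset_leq_card/subsetP => _ /imsetP[z + ->].
  by rewrite !inE /= => /and4P[_ _ -> _]; rewrite eqxx.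
move=> z z'; rewrite !inE /= !inE negb_or.
move=> /and4P[_ /andP[/andP[_ xz] /andP[yz _]] _ _] _ /setP/(_ z).
by rewrite !inE eqxx !orbT ![z == _]eq_sym (negbTE xz) (negbTE yz) => /esym /eqP.
Qed.

Lemma card_swap12 (T : finType) (H : {set {set T}}) (s : nat) t :
  three_graph H -> #|swap12 (heavy H s) t| <= 9 * max_degree H.
Proof.
move=> /forall_inP H3.
have sub : swap12 (heavy H s) t \subset \bigcup_(e in [set e in H | t.2 \in e]) setX e e.
  apply/subsetP => -[x y]; rewrite !inE /= => /and5P[_ _ _ eH _].
  by apply/bigcupP; exists [set x; y; t.2]; rewrite !inE ?eH !eqxx !orbT.
apply: leq_trans (subset_leq_card sub) _.
apply: leq_trans (leq_card_bigcup _ _) _.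
rewrite mulnC; apply: leq_trans (leq_mul (degree_le H t.2) (leqnn 9)).
rewrite -sum_nat_const; apply: leq_sum => e; rewrite inE => /andP[eH _].
by rewrite cardsX (eqP (H3 e eH)).
Qed.

(* A colour consists of a part of a tripartition and two field elements: the
   first one is the value of a vertex of part 0 or 1, while both together give
   the slope and the intercept of a line for a vertex of part 2. *)
Notation color F := ('I_3 * (F * F))%type.

Definition p0 : 'I_3 := @Ordinal 3 0 isT.
Definition p1 : 'I_3 := @Ordinal 3 1 isT.
Definition p2 : 'I_3 := @Ordinal 3 2 isT.

(** A nonzero slope makes the first coordinate of a point on the line determined by the second
    one. *)
Definition on_line (F : finFieldType) (cx cy cz : color F) : bool :=
  [&& cx.1 == p0, cy.1 == p1, cz.1 == p2, cz.2.1 != 0%R &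
      cy.2.1 == (cz.2.1 * cx.2.1 + cz.2.2)%R].

(** * Probabilities for random colourings *)

Lemma card_color (F : finType) : #|{: color F}| = 3 * #|F| ^ 2.
Proof. by rewrite !card_prod card_ord mulnn. Qed.

Lemma card_color_part (F : finType) (i : 'I_3) :
  #|[pred c : color F | c.1 == i]| = #|F| ^ 2.
Proof.
transitivity #|setX [set i] [set: F * F]|.
  by apply: eq_card => -[j u]; rewrite !inE andbT.
by rewrite cardsX cards1 cardsT card_prod mul1n mulnn.
Qed.

Lemma card_color_value (F : finType) (a : F) :
  #|[pred c : color F | c.2.1 == a]| = 3 * #|F|.
Proof.
transitivity #|setX [set: 'I_3] (setX [set a] [set: F])|.
  by apply: eq_card => -[j [u v]]; rewrite !inE andbT.
by rewrite !cardsX cards1 !cardsT card_ord mul1n.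
Qed.

Lemma card_color_line (F : finType) (l : F * F) :
  #|[pred c : color F | c.2 == l]| = 3.
Proof.
transitivity #|setX [set: 'I_3] [set l]|.
  by apply: eq_card => -[j u]; rewrite !inE.
by rewrite cardsX cards1 cardsT card_ord muln1.
Qed.

(** Each nonzero slope [m] admits exactly one intercept, [b - m * a]. *)
Lemma card_color_through (F : finFieldType) (a b : F) :
  #|[pred c : color F | [&& c.1 == p2, c.2.1 != 0%R & b == (c.2.1 * a + c.2.2)%R]]|
    = #|F|.-1.
Proof.
have <- : #|[set (p2, (m, b - m * a)%R) | m in [set~ (0%R : F)]]| = #|F|.-1.
  by rewrite card_imset ?cardsC1 // => m m' [].
apply: eq_card => -[j [m d]]; rewrite !inE /=.
apply/and3P/imsetP => [[/eqP -> m0 /eqP ->] | [m' + [-> -> ->]]].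
  by exists m; rewrite ?inE // addrC addKr.
by rewrite !inE => m0; split=> //; rewrite addrC subrK.
Qed.

(** With [q = #|F|], colouring [x], [y], [z] in turn succeeds with probabilities [1 / 3], [1 / 3]
    and [(q - 1) / (3 * q ^ 2)]. *)
Lemma card_on_line (T : finType) (F : finFieldType) (x y z : T) :
  uniq [:: x; y; z] ->
  #|[set f : {ffun T -> color F} | on_line (f x) (f y) (f z)]| * (27 * #|F| ^ 2)
    = #|F|.-1 * #|{ffun T -> color F}|.
Proof.
rewrite /= !inE negb_or => /and3P[/andP[xy xz] yz _].
have cF : 0 < #|F| by apply/card_gt0P; exists 0%R.
pose E1 (f : {ffun T -> color F}) := true && ((f x).1 == p0).
pose E2 (f : {ffun T -> color F}) := E1 f && ((f y).1 == p1).
have H1 : #|[set f | E1 f]| * #|{: color F}| = #|F| ^ 2 * #|[set f : {ffun T -> color F} | true]|.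
  apply: (card_recolor (E := fun=> true) (S := fun=> [pred c : color F | c.1 == p0])) => // f _.
  exact: card_color_part.
have H2 : #|[set f | E2 f]| * #|{: color F}| = #|F| ^ 2 * #|[set f | E1 f]|.
  apply: (card_recolor (E := E1) (S := fun=> [pred c : color F | c.1 == p1])) => // [f c | f _].
    by rewrite /E1 recolor_other.
  exact: card_color_part.
have H3 : #|[set f : {ffun T -> color F} | on_line (f x) (f y) (f z)]| * #|{: color F}|
    = #|F|.-1 * #|[set f | E2 f]|.
  rewrite -(card_recolor (E := E2) (v := z) (S := fun f => [pred c : color F |
     [&& c.1 == p2, c.2.1 != 0%R & (f y).2.1 == (c.2.1 * (f x).2.1 + c.2.2)%R]])).
  - by congr (_ * _); apply: eq_card => f; rewrite !inE /E2 /E1 /on_line /= andbA.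
  - by move=> f c; rewrite /E2 /E1 !recolor_other.
  - by move=> f c c'; rewrite /= !recolor_other.
  - by move=> f _; exact: card_color_through.
have HT : #|[set f : {ffun T -> color F} | true]| = #|{ffun T -> color F}|.
  by rewrite -[RHS]cardsT; apply: eq_card => f; rewrite !inE.
rewrite HT in H1; move: H1 H2 H3; rewrite card_color.
have Q_gt0 : 0 < #|F| ^ 2 by rewrite expn_gt0 cF.
have cancelQ m n : m * (3 * #|F| ^ 2) = #|F| ^ 2 * n -> n = m * 3.
  by move=> mn; apply/eqP; rewrite -(eqn_pmul2l Q_gt0) -mn mulnA mulnC.
move=> /cancelQ -> /cancelQ -> H3.
by rewrite -[27]/(9 * 3) -(mulnA 9) mulnCA H3 -!mulnA mulnCA (mulnC 9).
Qed.

(** As [E] ignores the colour of [v], that colour remains uniform given [E] and given the colour of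
    [w]. *)
Lemma card_same_value (T : finType) (F : finFieldType) (E : pred {ffun T -> color F})
    (v w : T) :
  (forall f c, E (recolor f v c) = E f) -> v != w ->
  #|[set f | E f && ((f v).2.1 == (f w).2.1)]| * #|F| = #|[set f | E f]|.
Proof.
move=> HE vw; have cF : 0 < #|F| by apply/card_gt0P; exists 0%R.
have := card_recolor (v := v) (S := fun f => [pred c : color F | c.2.1 == (f w).2.1]) (m := 3 * #|F|) HE.
rewrite card_color /= => H; have {}H := H _ _.
apply/eqP; rewrite -(eqn_pmul2l (m := 3 * #|F|)) ?muln_gt0 //; apply/eqP.
rewrite -H => [|f c c' | f _]; last exact: card_color_value.
  by rewrite mulnCA -mulnA mulnn.
by rewrite /= recolor_other // eq_sym.
Qed.

Lemma card_same_line (T : finType) (F : finFieldType) (E : pred {ffun T -> color F})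
    (v w : T) :
  (forall f c, E (recolor f v c) = E f) -> v != w ->
  #|[set f | E f && ((f v).2 == (f w).2)]| * #|F| ^ 2 = #|[set f | E f]|.
Proof.
move=> HE vw.
have := card_recolor (v := v) (S := fun f => [pred c : color F | c.2 == (f w).2]) (m := 3) HE.
rewrite card_color /= => H; have {}H := H _ _.
apply/eqP; rewrite -(eqn_pmul2l (m := 3)) //; apply/eqP.
rewrite -H => [|f c c' | f _]; last exact: card_color_line.
  by rewrite mulnCA.
by rewrite /= recolor_other // eq_sym.
Qed.

(** * Surviving triples and the absence of copies of F *)

(** Only the field elements are compared, not the parts; this may discard more triples but makes
    each single collision have probability exactly [1 / #|F|], or [1 / #|F| ^ 2] for lines. *)
Definition survives (T : finType) (F : finFieldType) (W : {set T * T * T})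
    (f : {ffun T -> color F}) (t : T * T * T) : bool :=
  [&& t \in W, on_line (f t.1.1) (f t.1.2) (f t.2),
      [forall x in swap1 W t, (f x).2.1 != (f t.1.1).2.1],
      [forall y in swap2 W t, (f y).2.1 != (f t.1.2).2.1],
      [forall z in swap3 W t, (f z).2 != (f t.2).2] &
      [forall p in swap12 W t, ~~ (((f p.1).2.1 == (f t.1.1).2.1)
                                   && ((f p.2).2.1 == (f t.1.2).2.1))]].

Lemma survives_part (T : finType) (F : finFieldType) (W : {set T * T * T})
    (f : {ffun T -> color F}) x y z :
  survives W f (x, y, z) -> [/\ (f x).1 = p0, (f y).1 = p1 & (f z).1 = p2].
Proof. by case/and3P=> _ /and5P[/eqP ? /eqP ? /eqP ? _ _] _. Qed.

(** The line of [z] has nonzero slope, so [x] and [x'] get the same value, which [swap1]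
    excludes. *)
Lemma survives_inj1 (T : finType) (F : finFieldType) (W : {set T * T * T})
    (f : {ffun T -> color F}) x x' y z :
  survives W f (x, y, z) -> survives W f (x', y, z) -> x = x'.
Proof.
case/and4P=> _ /and5P[_ _ _ /= m0 /eqP yE] /forall_inP noswap _.
case/and3P=> W' /and5P[_ _ _ _ /= /eqP yE'] _.
apply/eqP/contraT; rewrite eq_sym => xx'.
have /noswap/eqP[] : x' \in swap1 W (x, y, z) by rewrite inE /= xx'.
by apply: (mulfI m0); apply: (addIr (f z).2.2); rewrite -yE -yE'.
Qed.

Lemma survives_inj2 (T : finType) (F : finFieldType) (W : {set T * T * T})
    (f : {ffun T -> color F}) x y y' z :
  survives W f (x, y, z) -> survives W f (x, y', z) -> y = y'.
Proof.
case/and5P=> _ /and5P[_ _ _ _ /= /eqP yE] _ /forall_inP noswap _.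
case/and3P=> W' /and5P[_ _ _ _ /= /eqP yE'] _.
apply/eqP/contraT; rewrite eq_sym => yy'.
have /noswap/eqP[] : y' \in swap2 W (x, y, z) by rewrite inE /= yy'.
by rewrite /= yE'.
Qed.

(* The points of [(x, y)] and [(x', y')] lie on the lines of both [a] and [b]. *)
Lemma survives_no_C4 (T : finType) (F : finFieldType) (W : {set T * T * T})
    (f : {ffun T -> color F}) x y x' y' a b :
  survives W f (x, y, a) -> survives W f (x, y, b) ->
  survives W f (x', y', a) -> survives W f (x', y', b) ->
  x != x' -> y != y' -> a = b.
Proof.
move=> S1 S2 S3 S4 xx' yy'.
have [xP yP _] := survives_part S1; have [xP' yP' _] := survives_part S3.
have neq01 u v : (f u).1 = p0 -> (f v).1 = p1 -> u != v.
  by move=> uP vP; apply/eqP => uv; move: uP; rewrite uv vP.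
move: S1 S2 S3 S4.
case/and5P=> _ /and5P[_ _ _ _ /= /eqP E1] _ _ /andP[/forall_inP no3 /forall_inP no12].
case/andP=> Wb /andP[/and5P[_ _ _ _ /= /eqP E2] _].
case/andP=> Wa' /andP[/and5P[_ _ _ _ /= /eqP E3] _].
case/andP=> _ /andP[/and5P[_ _ _ _ /= /eqP E4] _].
(* If the first coordinates agree, the line of [a] makes the two points equal, which [swap12]
   excludes. *)
have [X|X] := eqVneq (f x).2.1 (f x').2.1.
  have /no12 : (x', y') \in swap12 W (x, y, a).
    rewrite inE /= !inE !negb_or Wa' ![_ == x]eq_sym xx' (neq01 x y') //.
    by rewrite (neq01 x' y) // [y' == y]eq_sym yy'.
  by rewrite /= E1 E3 X !eqxx.
apply/eqP/contraT; rewrite eq_sym => ab.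
have /no3/eqP[] : b \in swap3 W (x, y, a) by rewrite inE /= ab.
(* Two points with distinct first coordinates determine the line, so [a] and [b] have the same slope
   and intercept, which [swap3] excludes. *)
have ma : (f b).2.1 = (f a).2.1.
  apply/eqP; rewrite -subr_eq0; have : (((f b).2.1 - (f a).2.1) * ((f x).2.1 - (f x').2.1) = 0)%R.
    rewrite mulrBl !mulrBr.
    have -> : ((f b).2.1 * (f x).2.1 = (f y).2.1 - (f b).2.2)%R by rewrite E2 addrK.
    have -> : ((f a).2.1 * (f x).2.1 = (f y).2.1 - (f a).2.2)%R by rewrite E1 addrK.
    have -> : ((f b).2.1 * (f x').2.1 = (f y').2.1 - (f b).2.2)%R by rewrite E4 addrK.
    have -> : ((f a).2.1 * (f x').2.1 = (f y').2.1 - (f a).2.2)%R by rewrite E3 addrK.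
    by rewrite !opprB !addrA !addrNK subrr.
  by move/eqP; rewrite mulf_eq0 !subr_eq0 (negbTE X) orbF.
rewrite [LHS]surjective_pairing [RHS]surjective_pairing ma; congr pair.
by apply: (addrI ((f a).2.1 * (f x).2.1)%R); rewrite -E1 -ma -E2.
Qed.

Lemma survives_uniq (T : finType) (F : finFieldType) (H : {set {set T}}) (s : nat)
    (f : {ffun T -> color F}) x y z :
  survives (heavy H s) f (x, y, z) -> uniq [:: x; y; z].
Proof. by case/andP; rewrite inE => /and3P[]. Qed.

Definition survivors (T : finType) (F : finFieldType) (W : {set T * T * T})
    (f : {ffun T -> color F}) : {set {set T}} :=
  [set [set t.1.1; t.1.2; t.2] | t in survives W f].

Lemma survivors_edge (T : finType) (F : finFieldType) (H : {set {set T}}) (s : nat)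
    (f : {ffun T -> color F}) a b c :
  let S := survives (heavy H s) f in [set a; b; c] \in survivors (heavy H s) f ->
  [\/ S (a, b, c), S (a, c, b), S (b, a, c) | [\/ S (b, c, a), S (c, a, b) | S (c, b, a)]].
Proof.
move=> S /imsetP[[[x y] z] St] /=.
move=> /(eq_set3 (survives_uniq St)); rewrite /S.
by case=> [||| []] <-; [constructor 1 | constructor 2 | constructor 3
  | constructor 4; constructor 1 | constructor 4; constructor 2 | constructor 4; constructor 3].
Qed.

(** The parts of the three vertices recover their order from the edge. *)
Lemma card_survivors (T : finType) (F : finFieldType) (H : {set {set T}}) (s : nat)
    (f : {ffun T -> color F}) :
  #|survivors (heavy H s) f| = #|survives (heavy H s) f|.
Proof.
apply: card_in_imset => -[[x y] z] [[x' y'] z'] St St' E.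
have [xP yP zP] := survives_part St; have [xP' yP' zP'] := survives_part St'.
by move: (eq_set3 (survives_uniq St') E); case=> [||| []] [] ? ? ?; subst;
  move: xP yP zP xP' yP' zP' => //= -> -> -> //.
Qed.

(** The edges [u1 u2 u3] and [u1 u2 v1] force [u3] and [v1] into the same part. In part 0 or 1 they
    coincide by injectivity; in part 2 they are lines through the points of both [u1 u2] and
    [v2 v3]. *)
Lemma survivors_berge_C4_free (T : finType) (F : finFieldType) (H : {set {set T}}) (s : nat)
    (f : {ffun T -> color F}) :
  ~ contains_copy berge_C4 (survivors (heavy H s) f).
Proof.
move=> /contains_berge_C4P [u1 [u2 [u3 [v1 [v2 [v3]]]]]].
rewrite /= !inE !negb_or -!andbA.
move=> [/and5P[u12 u13 u1v1 u1v2 /andP[u1v3 /and5P[u23 u2v1 u2v2 u2v3 /and4P[u3v1 _ _ _]]]]].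
have [p01 p02 p12] : [/\ p0 <> p1, p0 <> p2 & p1 <> p2] by [].
move=> /survivors_edge E1 /survivors_edge E2 /survivors_edge E3 /survivors_edge E4.
case: E1 => [||| []] S1; have [? ? ?] := survives_part S1;
case: E2 => [||| []] S2; have [? ? ?] := survives_part S2; try congruence;
try (by move: u3v1; rewrite (survives_inj1 S1 S2) eqxx);
try (by move: u3v1; rewrite (survives_inj2 S1 S2) eqxx);
case: E3 => [||| []] S3; have [? ? ?] := survives_part S3; try congruence;
case: E4 => [||| []] S4; have [? ? ?] := survives_part S4; try congruence;
by move: u3v1; rewrite (survives_no_C4 S1 S2 S3 S4) ?eqxx.
Qed.

(** * The expected number of survivors *)

Lemma on_line_survives (T : finType) (F : finFieldType) (W : {set T * T * T})
    (t : T * T * T) (E := fun f : {ffun T -> color F} => on_line (f t.1.1) (f t.1.2) (f t.2)) :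
  t \in W ->
  [set f | E f] \subset [set f | survives W f t]
    :|: \bigcup_(v in swap1 W t) [set f | E f && ((f v).2.1 == (f t.1.1).2.1)]
    :|: \bigcup_(v in swap2 W t) [set f | E f && ((f v).2.1 == (f t.1.2).2.1)]
    :|: \bigcup_(v in swap3 W t) [set f | E f && ((f v).2 == (f t.2).2)]
    :|: \bigcup_(p in swap12 W t) [set f | (E f && ((f p.1).2.1 == (f t.1.1).2.1))
                                            && ((f p.2).2.1 == (f t.1.2).2.1)].
Proof.
move=> tW; apply/subsetP => f; rewrite !inE => Ef.
apply/contraT; rewrite !negb_or -!andbA => /and5P[].
rewrite /survives tW -/(E f) Ef /= => /negP nS N1 N2 N3 N4; case: nS.
apply/and4P; split.
- apply/forall_inP => v vW; apply: contra N1 => fv.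
  by apply/bigcupP; exists v => //; rewrite inE Ef.
- apply/forall_inP => v vW; apply: contra N2 => fv.
  by apply/bigcupP; exists v => //; rewrite inE Ef.
- apply/forall_inP => v vW; apply: contra N3 => fv.
  by apply/bigcupP; exists v => //; rewrite inE Ef.
- apply/forall_inP => v vW; apply: contra N4 => fv.
  by apply/bigcupP; exists v => //; rewrite inE -andbA Ef.
Qed.

(** Given the incidence, the collisions have total probability at most [3/16 + 3/16 + 10/256 < 1/2],
    so [A <= 2 * S]. Moreover [A] is at least [N / (54 * q)], as [q <= 2 * q.-1]. *)
Lemma survival_count (N A S b1 b2 b3 b4 n1 n2 n3 n4 s q : nat) :
  0 < s -> 16 * s <= q -> A * (27 * q ^ 2) = q.-1 * N ->
  A <= S + b1 + b2 + b3 + b4 ->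
  b1 * q <= n1 * A -> b2 * q <= n2 * A -> b3 * q ^ 2 <= n3 * A -> b4 * q ^ 2 <= n4 * A ->
  n1 <= 3 * s -> n2 <= 3 * s -> n3 <= s ^ 2 -> n4 <= 9 * s ^ 2 ->
  N <= 108 * q * S.
Proof.
move=> s_gt0 sq AN AS B1 B2 B3 B4 N1 N2 N3 N4.
have q_gt0 : 0 < q by lia.
have q2_gt0 : 0 < q ^ 2 by rewrite expn_gt0 q_gt0.
have C1 : 16 * b1 <= 3 * A.
  have : 16 * b1 * q <= 3 * A * q.
    have : n1 * A <= 3 * s * A by rewrite leq_mul2r N1 orbT.
    have : 16 * s * A <= q * A by rewrite leq_mul2r sq orbT.
    lia.
  by rewrite leq_pmul2r.
have C2 : 16 * b2 <= 3 * A.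
  have : 16 * b2 * q <= 3 * A * q.
    have : n2 * A <= 3 * s * A by rewrite leq_mul2r N2 orbT.
    have : 16 * s * A <= q * A by rewrite leq_mul2r sq orbT.
    lia.
  by rewrite leq_pmul2r.
have sq2 : 256 * s ^ 2 <= q ^ 2 by have := leq_mul sq sq; rewrite !mulnn expnMn.
have sqA : 256 * s ^ 2 * A <= q ^ 2 * A by rewrite leq_mul2r sq2 orbT.
have C3 : 256 * (b3 + b4) <= 10 * A.
  have : 256 * (b3 + b4) * q ^ 2 <= 10 * A * q ^ 2.
    have : n3 * A <= s ^ 2 * A by rewrite leq_mul2r N3 orbT.
    have : n4 * A <= 9 * s ^ 2 * A by rewrite leq_mul2r N4 orbT.
    lia.
  by rewrite leq_pmul2r.
have AS2 : A <= 2 * S by lia.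
rewrite -(leq_pmul2l q_gt0).
have : A * (27 * q ^ 2) <= 2 * S * (27 * q ^ 2) by rewrite leq_mul2r AS2 orbT.
have : q * N <= 2 * q.-1 * N by rewrite leq_mul2r; apply/orP; right; lia.
lia.
Qed.

Lemma card_survives_ge (T : finType) (F : finFieldType) (H : {set {set T}}) (s : nat) t :
  three_graph H -> max_degree H <= s ^ 2 -> 0 < s -> 16 * s <= #|F| ->
  t \in heavy H s ->
  #|{ffun T -> color F}| <=
    108 * #|F| * #|[set f : {ffun T -> color F} | survives (heavy H s) f t]|.
Proof.
move=> H3 dH s_gt0 sF tW.
pose E (f : {ffun T -> color F}) := on_line (f t.1.1) (f t.1.2) (f t.2).
have : uniq [:: t.1.1; t.1.2; t.2] by move: tW; rewrite inE => /and3P[].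
move=> xyz; have /= := xyz; rewrite !inE negb_or => /and3P[/andP[xy xz] yz _].
have recE v : v \notin [:: t.1.1; t.1.2; t.2] -> forall f c, E (recolor f v c) = E f.
  rewrite !inE !negb_or => /and3P[vx vy vz] f c.
  by rewrite /E !recolor_other // eq_sym.
apply: (survival_count s_gt0 sF (card_on_line F xyz)).
- apply: leq_trans (subset_leq_card (on_line_survives F tW)) _.
  by do 4![apply: leq_trans (leq_card_setU _ _).1 _; apply: leq_add; last exact: leqnn].
- apply: leq_card_bigcup_mul => v; rewrite inE => /andP[vx].
  rewrite inE /= => /and3P[/and3P[+ + _] _ _]; rewrite !inE negb_or => /andP[v1 v2] v3.
  by apply: (card_same_value (E := E)) => //; apply: recE; rewrite !inE !negb_or vx v1.
- apply: leq_card_bigcup_mul => v; rewrite inE => /andP[vy].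
  rewrite inE /= => /and3P[/and3P[+ + _] _ _]; rewrite !inE negb_or => /andP[v1 v2] v3.
  by apply: (card_same_value (E := E)) => //; apply: recE; rewrite !inE !negb_or vy eq_sym v1.
- apply: leq_card_bigcup_mul => v; rewrite inE => /andP[vz].
  rewrite inE /= => /and3P[/and3P[+ + _] _ _]; rewrite !inE negb_or => /andP[v1 v2] v3.
  by apply: (card_same_line (E := E)) => //; apply: recE; rewrite !inE !negb_or vz ![v == _]eq_sym v2 v3.
- apply: leq_card_bigcup_mul => -[v w]; rewrite inE /= !inE !negb_or.
  move=> /and3P[/andP[vx vy] /andP[wx wy]].
  move=> /and3P[/= /and3P[+ + _] _ _]; rewrite !inE negb_or => /andP[vw vz] wz.
  (* The collision of [w] is counted given that of [v]; since [w] differs from [v], each costs a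
     factor [#|F|]. *)
  rewrite -mulnn mulnA (card_same_value (E := fun f => E f && ((f v).2.1 == (f t.1.1).2.1))) //.
    by apply: (card_same_value (E := E)) => //; apply: recE; rewrite !inE !negb_or vx vy vz.
  move=> f c; rewrite recE ?inE ?negb_or ?wx ?wy ?wz //.
  by rewrite !recolor_other // eq_sym.
- exact: card_swap1.
- exact: card_swap2.
- exact: leq_trans (card_swap3 _ _ _) dH.
- by apply: leq_trans (card_swap12 _ _ H3) _; rewrite leq_mul2l.
Qed.

(** Surviving pairs of a triple and a colouring are counted twice: each triple survives in a
    fraction at least [1 / (108 * #|F|)] of the colourings, and each colouring has at most
    [ex_number H berge_C4] survivors. *)
Lemma card_heavy (T : finType) (F : finFieldType) (H : {set {set T}}) (s : nat) :
  three_graph H -> max_degree H <= s ^ 2 -> 0 < s -> 16 * s <= #|F| ->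
  #|heavy H s| <= 108 * #|F| * ex_number H berge_C4.
Proof.
move=> H3 dH s_gt0 sF; set W := heavy H s.
have N_gt0 : 0 < #|{ffun T -> color F}|.
  by apply/card_gt0P; exists [ffun=> (p0, (0%R, 0%R))].
rewrite -(leq_pmul2r N_gt0) -sum_nat_const.
have le_ex (f : {ffun T -> color F}) : #|survives W f| <= ex_number H berge_C4.
  rewrite -card_survivors; apply: leq_ex_number; last exact: survivors_berge_C4_free.
  apply/subsetP => _ /imsetP[t + ->] => /andP[+ _].
  by rewrite inE => /and3P[].
apply: (@leq_trans (\sum_(t in W)
    108 * #|F| * #|[set f : {ffun T -> color F} | survives W f t]|)).
  by apply: leq_sum => t tW; exact: card_survives_ge.
rewrite -big_distrr /= -[X in _ <= X]mulnA leq_mul2l; apply/orP; right.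
under eq_bigr => t _ do rewrite -sum1dep_card.
rewrite (exchange_big_dep xpredT) //= mulnC -sum_nat_const.
rewrite (eq_bigl xpredT) //; apply: leq_sum => f _.
apply: leq_trans (le_ex f); rewrite sum1_card.
by apply/subset_leq_card/subsetP => t /andP[].
Qed.

(** * Combining both kinds of edges and choosing the field *)

Lemma leq_ex_number_berge_C4 (T : finType) (F : finFieldType) (H : {set {set T}}) (s : nat) :
  three_graph H -> max_degree H <= s ^ 2 -> 0 < s -> 16 * s <= #|F| ->
  #|H| <= 109 * #|F| * ex_number H berge_C4.
Proof.
move=> H3 dH s_gt0 sF.
set L := [set e in H | [forall x in e, forall y in e, (x != y) ==> (codegree H x y < s)]].
have cover : H \subset L :|: [set [set t.1.1; t.1.2; t.2] | t in heavy H s].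
  apply/subsetP => e eH; rewrite in_setU.
  have [//|/=] := boolP (e \in L); rewrite inE eH /=.
  rewrite negb_forall_in => /exists_inP[x xe]; rewrite negb_forall_in => /exists_inP[y ye].
  rewrite negb_imply -leqNgt => /andP[xy xyH].
  have /card_gt0P[z] : 0 < #|e :\ x :\ y|.
    move: (forall_inP H3 e eH); rewrite (cardsD1 x) xe (cardsD1 y) !inE [y == x]eq_sym xy ye.
    by rewrite !add1n !eqSS => /eqP ->.
  rewrite !inE => /and3P[zy zx ze].
  have eE : e = [set x; y; z].
    apply/esym/eqP; rewrite eqEcard !subUset !sub1set xe ye ze /=.
    rewrite (eqP (forall_inP H3 e eH)) setUC cardsU1 cards2 !inE negb_or.
    by rewrite zx zy xy.
  apply/imsetP; exists (x, y, z) => //; rewrite !inE /= -eE eH xyH !inE negb_or.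
  by rewrite xy ![_ == z]eq_sym zx zy.
apply: leq_trans (subset_leq_card cover) _.
apply: leq_trans (leq_card_setU _ _).1 _.
have B1 := card_low_codegree s H3; rewrite -/L in B1.
have B2 := leq_trans (leq_imset_card (fun t => [set t.1.1; t.1.2; t.2]) (heavy H s))
  (card_heavy H3 dH s_gt0 sF).
apply: leq_trans (leq_add B1 B2) _.
(* [9 * s + 108 * #|F| <= 109 * #|F|], since [16 * s <= #|F|]. *)
rewrite -mulnDl leq_mul2r; apply/orP; right; lia.
Qed.

(** For the least [s], either [s = 1], or [s <= 2 * (s - 1)] with [(s - 1) ^ 2 < n]. *)
Lemma exists_sqrt_ceil (n : nat) : 0 < n -> exists2 s, n <= s ^ 2 & s ^ 2 <= 4 * n.
Proof.
move=> n_gt0.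
have ex : exists s, n <= s ^ 2 by exists n; rewrite -mulnn leq_pmulr.
case: (ex_minnP ex) => s ns mins; exists s => //.
case: s ns mins => [|[|s]] // ns mins; first by rewrite muln_gt0.
have : ~~ (n <= s.+1 ^ 2) by apply/negP => /mins; rewrite ltnn.
rewrite -ltnNge -!mulnn; nia.
Qed.

Lemma ex_number_berge_C4_sqrt (T : finType) (H : {set {set T}}) (Delta : nat) :
  0 < Delta -> three_graph H -> max_degree H <= Delta ->
  exists s, s ^ 2 <= 4 * Delta /\ #|H| <= 4000 * s * ex_number H berge_C4.
Proof.
move=> D_gt0 H3 dH; have [s Ds sD] := exists_sqrt_ceil D_gt0.
exists s; split=> //.
have s_gt0 : 0 < s by case: s Ds {sD} => //; rewrite leqn0; case: Delta D_gt0 dH.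
(* The order [32 * 2 ^ trunc_log 2 s] lies between [16 * s] and [32 * s], and [109 * 32 <= 4000]. *)
have [F _ cF] := pPrimePowerField (isT : prime 2) (isT : 0 < (trunc_log 2 s).+4.+1).
have /andP[lo hi] := trunc_log_bounds (isT : 1 < 2) s_gt0.
have := leq_ex_number_berge_C4 (F := F) H3 (leq_trans dH Ds) s_gt0.
rewrite cF; have -> : 2 ^ (trunc_log 2 s).+4.+1 = 32 * 2 ^ trunc_log 2 s by rewrite !expnS; lia.
rewrite expnS in hi.
move=> /(_ _) H'; apply: leq_trans (H' _) _; first by lia.
rewrite leq_mul2r; apply/orP; right; lia.
Qed.

(** * Real exponents and the asymptotic bound *)

Lemma leq_natr_powR (R : realType) (a b m n : nat) :
  0 < n -> a ^ n <= b ^ m -> (a%:R <= (b%:R : R) `^ (m%:R / n%:R))%R.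
Proof.
move=> n_gt0 ab; have nR : (n%:R != 0 :> R)%R by rewrite pnatr_eq0 -lt0n.
have -> : (a%:R = (a%:R `^ n%:R) `^ n%:R^-1 :> R)%R by rewrite -powRrM mulfV // powRr1.
rewrite powRrM ge0_ler_powR ?invr_ge0 ?nnegrE ?powR_ge0 //.
by rewrite !powR_mulrn // -!natrX ler_nat.
Qed.

Unset Implicit Arguments.
Local Open Scope ring_scope.

Theorem theorem1p5 (R : realType) (eps : R) (eps_gt0 : 0 < eps) :
  exists Delta0 : nat, forall Delta : nat, (Delta0 <= Delta)%N ->
    forall (T : finType) (H : {set {set T}}),
      three_graph H -> (max_degree H <= Delta)%N ->
      (Delta%:R : R) `^ (- (3 / 5) - eps) * (#|H|)%:R
        <= (ex_number H berge_C4)%:R.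
Proof.
(* The threshold yields [(C * s) ^ 10 <= C ^ 10 * (4 * Delta) ^ 5 <= Delta ^ 6]; taking tenth roots
   gives the exponent [3 / 5]. *)
suff main (C : nat) : (0 < C)%N ->
    forall Delta : nat, (C ^ 10 * 4 ^ 5 <= Delta)%N ->
    forall (T : finType) (H : {set {set T}}) (s : nat),
      (s ^ 2 <= 4 * Delta)%N -> (#|H| <= C * s * ex_number H berge_C4)%N ->
      (Delta%:R : R) `^ (- (3 / 5) - eps) * (#|H|)%:R <= (ex_number H berge_C4)%:R.
  exists (4000 ^ 10 * 4 ^ 5)%N => Delta leD T H H3 dH.
  have D_gt0 : (0 < Delta)%N by apply: leq_trans leD; rewrite muln_gt0 !expn_gt0.
  have [s [sD Hs]] := ex_number_berge_C4_sqrt D_gt0 H3 dH.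
  exact: (main 4000 isT Delta leD T H s sD Hs).
move=> C_gt0 D leD T H s sD Hs.
have D_gt0 : (0 < D)%N by apply: leq_trans leD; rewrite muln_gt0 !expn_gt0 C_gt0.
have D1 : 1 <= D%:R :> R by rewrite ler1n.
have CsD : (C * s)%:R <= (D%:R : R) `^ (3 / 5 + eps).
  apply: (@le_trans _ _ ((D%:R : R) `^ (6%:R / 10%:R))).
    apply: leq_natr_powR => //; rewrite expnMn (expnM s 2 5).
    rewrite (expnS D 5); apply: leq_trans (leq_mul leD (leqnn _)).
    by rewrite -mulnA -expnMn leq_mul2l leq_exp2r // sD orbT.
  apply: ler_powR => //.
  have -> : (6%:R / 10%:R = 3 / 5 :> R) by lra.
  by rewrite lerDl ltW.
rewrite -opprD powRN mulrC ler_pdivrMr ?powR_gt0 ?ltr0n //.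
apply: (@le_trans _ _ ((C * s)%:R * (ex_number H berge_C4)%:R)).
  by rewrite -natrM ler_nat.
by rewrite mulrC ler_wpM2l.
Qed.
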